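(* Let $G$ and $H$ be graphs. Then: (i) $\mathcal{R}(G,K_2)$ is empty if and only if $G$ is self-embeddable; and if $\mathcal{R}(G,K_2)$ is nonempty, then $\mathcal{R}(G,K_2)=\{G\}$; (ii) if $H \neq K_2$ (that is, $H$ is not isomorphic to $K_2$), then $G \to (G,H)$ implies that $\mathcal{R}(G,H)$ is empty.
   Context: All graphs are simple, countable (finite or countably infinite), nonempty, and have no isolated vertices (so the given graphs have at least one edge); collections of graphs are considered up to isomorphism. $K_2$ is the graph consisting of a single edge. A subgraph $H$ of $G$ has $V(H)\subseteq V(G)$ and $E(H)\subseteq E(G)$; it is proper if $E(H)$ is a proper subset of $E(G)$. A graph is self-embeddable if it is isomorphic to one of its proper subgraphs. We write $F \to (G,H)$ if every red-blue coloring of the edges of $F$ produces a subgraph isomorphic to $G$ with all edges red or a subgraph isomorphic to $H$ with all edges blue. A graph $F$ is $(G,H)$-minimal if $F \to (G,H)$ and no proper subgraph $F'$ of $F$ satisfies $F' \to (G,H)$. $\mathcal{R}(G,H)$ denotes the collection of all $(G,H)$-minimal graphs. *)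

(* Defs.v *)
From mathcomp Require Import all_boot.
From mathcomp Require Import mathcomp_extra boolp classical_sets functions.
From mathcomp Require Import cardinality.

Set Implicit Arguments.
Unset Strict Implicit.
Unset Printing Implicit Defensive.

Local Open Scope classical_set_scope.

(* The vertices form a subset of an ambient type T, so that a graph and its
   subgraphs share T and inclusions are literal; T itself is arbitrary, and only
   the vertex set is required to be countable. Edges are unordered pairs. *)
Record graph (T : Type) := Graph {
  vertices : set T;
  edges : set (set T);
  edgesP : forall e, edges e ->
    exists x y, [/\ vertices x, vertices y, x <> y & e = [set x; y]];
  vertices_countable : countable vertices;
  vertices_nonempty : vertices !=set0;
  no_isolated : forall x, vertices x -> exists y, edges [set x; y]
}.

Definition subgraph (T : Type) (H G : graph T) : Prop :=
  vertices H `<=` vertices G /\ edges H `<=` edges G.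

Definition proper_subgraph (T : Type) (H G : graph T) : Prop :=
  subgraph H G /\ edges H `<` edges G.

(* The values of f outside [vertices G] are irrelevant. *)
Definition isomorphic (T U : Type) (G : graph T) (H : graph U) : Prop :=
  exists f : T -> U,
    set_bij (vertices G) (vertices H) f /\
    (forall x y, vertices G x -> vertices G y ->
       (edges G [set x; y] <-> edges H [set f x; f y])).

Definition self_embeddable (T : Type) (G : graph T) : Prop :=
  exists2 G' : graph T, proper_subgraph G' G & isomorphic G G'.

Inductive color := Red | Blue.

(* A coloring is given on all subsets of T; only its values on [edges F] are
   ever used. *)
Definition has_mono_copy (T U : Type) (F : graph T) (c : set T -> color)
    (k : color) (G : graph U) : Prop :=
  exists K : graph T,
    [/\ subgraph K F, isomorphic K G & forall e, edges K e -> c e = k].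

Definition arrows (T U W : Type) (F : graph T) (G : graph U) (H : graph W) :
    Prop :=
  forall c : set T -> color,
    has_mono_copy F c Red G \/ has_mono_copy F c Blue H.

Definition ramsey_minimal (T U W : Type) (F : graph T) (G : graph U)
    (H : graph W) : Prop :=
  arrows F G H /\
  ~ exists2 F' : graph T, proper_subgraph F' F & arrows F' G H.

Definition any_graph := {T : Type & graph T}.

(* A collection of graphs up to isomorphism is represented by the
   isomorphism-closed set of its members, over all ambient types; thus the
   collection {G} is [iso_class G]. *)
Definition ramsey_class (U W : Type) (G : graph U) (H : graph W) :
    set any_graph :=
  [set F | ramsey_minimal (projT2 F) G H].

Definition iso_class (U : Type) (G : graph U) : set any_graph :=
  [set F | isomorphic (projT2 F) G].

Fact K2_edgesP (e : set bool) : [set [set true; false]] e ->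
  exists x y, [/\ [set: bool] x, [set: bool] y, x <> y & e = [set x; y]].
Proof. by move=> ->; exists true, false. Qed.

Fact K2_countable : countable [set: bool].
Proof. exact: countableP. Qed.

Fact K2_nonempty : [set: bool] !=set0.
Proof. by exists true. Qed.

Fact K2_no_isolated (x : bool) : [set: bool] x ->
  exists y, [set [set true; false]] [set x; y].
Proof. by case: x => _; [exists false | exists true; rewrite setUC]. Qed.

Definition K2 : graph bool :=
  Graph K2_edgesP K2_countable K2_nonempty K2_no_isolated.

(* Main.v *)
(* Since a blue edge is a blue copy of K2, F -> (G, K2) just says that F
   contains a copy of G; hence the (G, K2)-minimal graphs are the copies of G
   that are not self-embeddable. For (ii), if F -> (G, H) and H has at least two
   edges, colour a single edge of F blue: this forces a copy of G avoiding that
   edge, and this copy still arrows (G, H), so F is not minimal. *)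
Require Import Defs.
From mathcomp Require Import all_boot.
From mathcomp Require Import mathcomp_extra boolp classical_sets functions.
From mathcomp Require Import cardinality.

Set Implicit Arguments.
Unset Strict Implicit.
Unset Printing Implicit Defensive.

Local Open Scope classical_set_scope.

(** * Images of edges under a map *)

Lemma image_set2 (T U : Type) (g : T -> U) (x y : T) :
  g @` [set x; y] = [set g x; g y].
Proof. by rewrite image_setU !image_set1. Qed.

Lemma set_inj_image (T U : Type) (V : set T) (g : T -> U) (A B : set T) :
  set_inj V g -> A `<=` V -> B `<=` V -> g @` A = g @` B -> A = B.
Proof.
move=> gI; suff H A' B' : A' `<=` V -> B' `<=` V -> g @` A' = g @` B' ->
    A' `<=` B' by move=> AV BV E; apply/seteqP; split; exact: H.
move=> AV BV E x Ax.
have [y By gyx] : (g @` B') (g x) by rewrite -E; exists x.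
by rewrite -(gI y x) ?inE //; [exact: BV | exact: AV].
Qed.

(** * Edges, vertices and subgraphs *)

Section Graphs.
Context {T : Type}.
Implicit Types G K : graph T.

Lemma edge_sub_vertices G e : edges G e -> e `<=` vertices G.
Proof. by move=> /(@edgesP _ G)[x [y [Vx Vy _ ->]]] z [->|->]. Qed.

Lemma graph_has_edge G : edges G !=set0.
Proof.
have [x Vx] := vertices_nonempty G; have [y Exy] := no_isolated Vx.
by exists [set x; y].
Qed.

(** No vertex is isolated, so the edge set determines the vertex set; graphs can then be compared by
    their edges alone. *)
Lemma vertices_bigcup_edges G : vertices G = \bigcup_(e in edges G) e.
Proof.
apply/seteqP; split => [x Vx|x [e Ee ex]].
  by have [y Exy] := no_isolated Vx; exists [set x; y] => //; left.
exact: edge_sub_vertices Ee _ ex.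
Qed.

Lemma subgraph_trans G1 G2 G3 :
  subgraph G1 G2 -> subgraph G2 G3 -> subgraph G1 G3.
Proof.
move=> [V12 E12] [V23 E23]; split; first exact: subset_trans V12 V23.
exact: subset_trans E12 E23.
Qed.

Lemma sub_proper_trans G1 G2 G3 :
  subgraph G1 G2 -> proper_subgraph G2 G3 -> proper_subgraph G1 G3.
Proof.
move=> S12 [S23 [_ nE]]; have S13 := subgraph_trans S12 S23.
split=> //; split=> [|E31]; first exact: S13.2.
by apply: nE => e /E31; exact: S12.2.
Qed.

End Graphs.

(** * Isomorphism as an equivalence relation *)

Section Isomorphism.
Context {T U W : Type}.

Lemma same_edges_isomorphic (G K : graph T) : edges G = edges K ->
  isomorphic G K.
Proof.
move=> E; exists id; rewrite !vertices_bigcup_edges E.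
by split=> //; split=> // x Vx; exists x.
Qed.

Lemma isomorphic_sym (G : graph T) (H : graph U) :
  isomorphic G H -> isomorphic H G.
Proof.
move=> [f [[fV fI fS] fE]]; have [x0 _] := vertices_nonempty G.
(* Choice yields an inverse [g] of [f]; [x0] is only a default value outside [vertices H]. *)
have /choice[g gP] (y : U) : exists x, vertices H y -> vertices G x /\ f x = y.
  have [Vy|nVy] := pselect (vertices H y); last by exists x0.
  by have [x Vx fxy] := fS _ Vy; exists x.
exists g; split; last first.
  move=> y z Vy Vz; have [Vgy {1}<-] := gP _ Vy; have [Vgz {1}<-] := gP _ Vz.
  by apply: iff_sym; exact: fE.
split=> [_ /gP[]//|y z /[!inE] /gP[_ fy] /gP[_ fz] gyz|x Vx].
  by rewrite -fy -fz gyz.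
have [Vg fg] := gP _ (fV _ Vx).
by exists (f x); [exact: fV|apply: fI; rewrite ?inE].
Qed.

Lemma isomorphic_trans (G : graph T) (H : graph U) (K : graph W) :
  isomorphic G H -> isomorphic H K -> isomorphic G K.
Proof.
move=> [f [fB fE]] [g [gB gE]]; have fV := set_bij_homo fB.
exists (g \o f); split; first exact: set_bij_comp fB gB.
move=> x y Vx Vy; apply: iff_trans (fE _ _ Vx Vy) _.
by apply: gE; exact: fV.
Qed.

End Isomorphism.

Lemma isomorphic_refl {T : Type} (G : graph T) : isomorphic G G.
Proof. exact: same_edges_isomorphic. Qed.

(** * Image of a graph under an injective map *)

Section ImageGraph.
Context {T U : Type} (g : T -> U) (G : graph T).
Hypothesis gI : set_inj (vertices G) g.

Fact image_graph_edgesP e : [set g @` e | e in edges G] e ->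
  exists x y, [/\ (g @` vertices G) x, (g @` vertices G) y, x <> y &
                  e = [set x; y]].
Proof.
move=> [e' Ee' <-]; have [x [y [Vx Vy xy ->]]] := edgesP Ee'.
exists (g x), (g y); split; [by exists x|by exists y| |exact: image_set2].
by move=> gxy; apply/xy/gI; rewrite ?inE.
Qed.

Fact image_graph_countable : countable (g @` vertices G).
Proof.
by apply: sub_countable (vertices_countable G); exact: card_image_le.
Qed.

Fact image_graph_nonempty : g @` vertices G !=set0.
Proof. exact: image_nonempty (vertices_nonempty G). Qed.

Fact image_graph_no_isolated x : (g @` vertices G) x ->
  exists y, [set g @` e | e in edges G] [set x; y].
Proof.
move=> [z Vz <-]; have [y Ezy] := no_isolated Vz.
exists (g y), [set z; y] => //.
exact: image_set2.
Qed.

(** Subgraphs share an ambient type, so a graph on [T] must be copied into [U] before it can be a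
    subgraph there. *)
Definition image_graph : graph U :=
  Graph image_graph_edgesP image_graph_countable image_graph_nonempty
    image_graph_no_isolated.

Lemma image_graph_isomorphic : isomorphic G image_graph.
Proof.
exists g; split; first by split=> // x Vx; exists x.
move=> x y Vx Vy; split=> [Exy|[e Ee]].
  by exists [set x; y]; rewrite ?image_set2.
(* An edge [e] with the same image as the pair of [x] and [y] is that pair, by injectivity on the
   vertices. *)
rewrite -image_set2 => /(set_inj_image gI) <- //.
  exact: edge_sub_vertices.
by move=> _ [->|->].
Qed.

End ImageGraph.

(** * Transport of subgraphs and arrowing along an isomorphism *)

Section Embedding.
Context {T U : Type} {G : graph T} {K : graph U} {g : T -> U}.
Hypothesis gB : set_bij (vertices G) (vertices K) g.
Hypothesis gE : forall x y, vertices G x -> vertices G y ->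
  (edges G [set x; y] <-> edges K [set g x; g y]).

Lemma sub_set_inj (G0 : graph T) : subgraph G0 G -> set_inj (vertices G0) g.
Proof.
move=> [V _] x y; rewrite !inE => /V Vx /V Vy.
by apply: (set_bij_inj gB); rewrite inE.
Qed.

Lemma image_subgraph (G0 : graph T) (S : subgraph G0 G) :
  subgraph (image_graph (sub_set_inj S)) K.
Proof.
have [V E] := S; split=> [_ [x /V Vx <-]|_ [e /E Ee <-]].
  exact: (set_bij_homo gB).
have [x [y [Vx Vy _ exy]]] := edgesP Ee.
by rewrite exy image_set2; apply/gE => //; rewrite -exy.
Qed.

Lemma image_proper_subgraph (G0 : graph T) (P : proper_subgraph G0 G) :
  proper_subgraph (image_graph (sub_set_inj P.1)) K.
Proof.
have [S [E nE]] := P; have S' := image_subgraph P.1.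
split=> //; split; first exact: S'.2.
(* If the image had every edge of [K], the image of an edge [e] of [G] would come from some edge
   [e'] of [G0]; injectivity gives [e' = e], so [G0] would have every edge of [G]. *)
move=> sub; apply: nE => e Ee.
have [x [y [Vx Vy _ exy]]] := edgesP Ee.
have [e' E' ee'] : [set g @` e | e in edges G0] (g @` e).
  by apply: sub; rewrite exy image_set2; apply/gE => //; rewrite -exy.
rewrite -(set_inj_image (set_bij_inj gB) _ _ ee') //.
  by apply: edge_sub_vertices; exact: E.
exact: edge_sub_vertices.
Qed.

End Embedding.

(** The proper copy [G'] of [G] is carried by [g] to a proper subgraph of [K], and [K], [G], [G']
    and this image are all isomorphic. *)
Lemma self_embeddable_isomorphic {T U : Type} (G : graph T) (K : graph U) :
  isomorphic G K -> self_embeddable G -> self_embeddable K.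
Proof.
move=> GK; have [g [gB gE]] := GK => -[G' P GG'].
exists (image_graph (sub_set_inj gB P.1)).
  exact: image_proper_subgraph.
apply: isomorphic_trans (isomorphic_sym GK) _.
exact: isomorphic_trans GG' (image_graph_isomorphic _).
Qed.

(** A coloring of [K] is pulled back to [F] along [g]; a monochromatic copy found in [F] is then
    pushed forward to [K] with its color. *)
Lemma has_mono_copy_isomorphic {T U W : Type} (F : graph T) (K : graph U)
    (g : T -> U) (c : set U -> color) (k : color) (G : graph W) :
  set_bij (vertices F) (vertices K) g ->
  (forall x y, vertices F x -> vertices F y ->
    (edges F [set x; y] <-> edges K [set g x; g y])) ->
  has_mono_copy F (fun e => c (g @` e)) k G -> has_mono_copy K c k G.
Proof.
move=> gB gE [F' [S F'G mono]]; exists (image_graph (sub_set_inj gB S)).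
split; first exact: image_subgraph.
- exact: isomorphic_trans (isomorphic_sym (image_graph_isomorphic _)) F'G.
- by move=> _ [e Ee <-]; exact: mono.
Qed.

Lemma arrows_isomorphic {T T' U W : Type} (F : graph T) (F' : graph T')
    (G : graph U) (H : graph W) :
  isomorphic F F' -> arrows F G H -> arrows F' G H.
Proof.
move=> [g [gB gE]] A c.
by case: (A (fun e => c (g @` e))) => /(has_mono_copy_isomorphic gB gE);
  [left|right].
Qed.

(** * Single edges and arrowing with [K2] *)

Lemma single_edge_subgraph {T : Type} (F : graph T) (e : set T) : edges F e ->
  exists K : graph T, [/\ subgraph K F, isomorphic K K2 & edges K = [set e]].
Proof.
move=> Ee; have [x [y [Vx Vy xy exy]]] := edgesP Ee.
pose g (b : bool) := if b then x else y.
have gI : set_inj (vertices K2) g.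
  by move=> [] [] // _ _ /esym.
have gE : edges (image_graph gI) = [set e].
  by rewrite /= image_set1 image_set2 -exy.
exists (image_graph gI); split=> //.
  by split=> [_ [[] _ <-]//|]; rewrite gE => _ ->.
exact: isomorphic_sym (image_graph_isomorphic _).
Qed.

Lemma single_edge_isomorphic_K2 {T : Type} (K : graph T) (e : set T) :
  edges K = [set e] -> isomorphic K K2.
Proof.
move=> Ke; have Ee : edges K e by rewrite Ke.
have [L [_ LK2 Le]] := single_edge_subgraph Ee.
by apply: isomorphic_trans LK2; apply: same_edges_isomorphic; rewrite Ke.
Qed.

Lemma arrows_K2P {T U : Type} (F : graph T) (G : graph U) :
  arrows F G K2 <-> exists2 K : graph T, subgraph K F & isomorphic K G.
Proof.
(* The all-red coloring excludes a blue copy of [K2], since a graph has at least one edge. *)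
split=> [/(_ (fun=> Red))[[K [S I _]]|[K [_ _ mono]]]|[K S I] c].
- by exists K.
- by have [e /mono] := graph_has_edge K.
have [[e Ee ce]|nblue] := pselect (exists2 e, edges F e & c e = Blue).
  right; have [L [LF LK2 Le]] := single_edge_subgraph Ee.
  by exists L; split=> // e'; rewrite Le => ->.
left; exists K; split=> // e /S.2 Ee.
by case ce : (c e) => //; case: nblue; exists e.
Qed.

Lemma ramsey_minimal_K2P {T U : Type} (F : graph T) (G : graph U) :
  ramsey_minimal F G K2 <-> isomorphic F G /\ ~ self_embeddable F.
Proof.
split=> [[/arrows_K2P[K S KG] minF]|[FG nself]]; last first.
  split; first by apply/arrows_K2P; exists F; first by split.
  move=> [F' P /arrows_K2P[K S KG]]; apply: nself.
  (* The copy [K] of [G] inside the proper subgraph [F'] is a proper copy of [F] itself. *)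
  exists K; first exact: sub_proper_trans S P.
  exact: isomorphic_trans FG (isomorphic_sym KG).
(* Minimality forces [K] to use all edges of [F]: otherwise [K] is a proper subgraph that still
   arrows. *)
have FG : isomorphic F G.
  apply: isomorphic_trans (KG); apply: same_edges_isomorphic.
  apply/seteqP; split; last exact: S.2.
  apply: contrapT => nE; apply: minF; exists K.
    by split=> //; split=> //; exact: S.2.
  by apply/arrows_K2P; exists K; first by split.
split=> // -[F' P FF']; apply: minF; exists F' => //.
apply/arrows_K2P; exists F'; first by split.
exact: isomorphic_trans (isomorphic_sym FF') FG.
Qed.

(** * Copies avoiding an edge, and the theorem *)

(** With [e] blue and all other edges red, a blue copy of [H] would have [e] as its only edge and so
    be a [K2]; hence a red copy of [G] exists, and it misses [e]. *)
Lemma arrows_avoid_edge {T U W : Type} (F : graph T) (G : graph U)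
    (H : graph W) (e : set T) :
  ~ isomorphic H K2 -> arrows F G H ->
  exists K : graph T, [/\ subgraph K F, isomorphic K G & ~ edges K e].
Proof.
move=> HK2 /(_ (fun e' => if `[< e' = e >] then Blue else Red)).
case=> -[K [S I mono]].
  exists K; split=> // /mono; by case: asboolP.
case: HK2; apply: isomorphic_trans (isomorphic_sym I) _.
have sub : edges K `<=` [set e] by move=> e' /mono; case: asboolP.
apply: (@single_edge_isomorphic_K2 _ K e); apply/seteqP; split=> // _ ->.
by have [e' Ee'] := graph_has_edge K; rewrite -(sub _ Ee').
Qed.

Theorem theorem12 (T U : Type) (G : graph T) (H : graph U) :
  ((ramsey_class G K2 = set0 <-> self_embeddable G) /\
   (ramsey_class G K2 !=set0 -> ramsey_class G K2 = iso_class G)) /\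
  (~ isomorphic H K2 -> arrows G G H -> ramsey_class G H = set0).
Proof.
split; first split.
- split=> [empty|self].
    apply: contrapT => nself.
    have : ramsey_class G K2 (existT _ T G).
      by apply/ramsey_minimal_K2P; split=> //; exact: isomorphic_refl.
    by rewrite empty.
  (* A minimal [F] would be a copy of [G] that is not self-embeddable, yet it inherits
     self-embeddability from [G]. *)
  apply/seteqP; split=> // F /ramsey_minimal_K2P[FG]; apply.
  exact: self_embeddable_isomorphic (isomorphic_sym FG) self.
- move=> [F /ramsey_minimal_K2P[FG nself]].
  apply/seteqP; split=> [F' /ramsey_minimal_K2P[]//|F' F'G].
  apply/ramsey_minimal_K2P; split=> // self; apply: nself.
  apply: self_embeddable_isomorphic self.
  exact: isomorphic_trans F'G (isomorphic_sym FG).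
- move=> HK2 GGH; apply/seteqP; split=> // -[T' F] [/= FGH]; apply.
  have [e Ee] := graph_has_edge F.
  have [K [S KG nKe]] := arrows_avoid_edge e HK2 FGH.
  (* [K] arrows because it is a copy of [G], and it is proper because [e] is an edge of [F] outside
     [K]. *)
  exists K; last exact: arrows_isomorphic (isomorphic_sym KG) GGH.
  by split=> //; split; [exact: S.2|move=> /(_ _ Ee)].
Qed.
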